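(* Let $A\in\mathbb{C}^{n\times n}$ be normal, with target eigenvectors $V_1=[v_1\ \cdots\ v_m]$, and let $r$ be a rational filter ordering the eigenvalues of $A$ as described in the context, with the dangerous eigenvalue $\lambda_1$ at distance $d$ from the pole $z_{j_*}$ of $r$. Given $Q_1\in\mathbb{C}^{n\times m}$ with orthonormal columns, let $X_2=r(A)Q_1$. Let $q_1^{(1)}$ be the first column of $Q_1$, and let $\tilde Q_1$ and $\tilde V_1$ be the $n\times(m-1)$ matrices formed by removing the first columns of $Q_1$ and $V_1$, respectively. Let $b=v_1^*\tilde Q_1$ and $D=\tilde V_1^*\tilde Q_1$ denote the upper-right and lower-right blocks of $$V_1^*Q_1=\begin{bmatrix} v_1^*q_1^{(1)} & v_1^*\tilde Q_1\\ \tilde V_1^*q_1^{(1)} & \tilde V_1^*\tilde Q_1\end{bmatrix}.$$ If $D$ is invertible and the first column of $Q_1$ satisfies $\|q_1^{(1)}-v_1\|=\mathcal{O}(d)$, then $\|b\|=\mathcal{O}(d)$ and $$\kappa(X_2T)\le M\left(\left(\frac{\|b\|}{d}+1\right)\frac{\|D^{-1}\|}{|r(\lambda_m)|}+1\right)+\mathcal{O}(d)\qquad\text{as } d\to0.$$ Here, $T=\mathrm{diag}(r(\lambda_1)^{-1},1,\ldots,1)\in\mathbb{C}^{m\times m}$ and $M=\|b\|/d+\max\{1,|r(\lambda_2)|\}$.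
   Context: Norms are spectral norms (Euclidean for vectors), and $\kappa(\cdot)$ is the 2-norm condition number of a rectangular matrix, i.e. the ratio of its largest to its smallest singular value. The normal matrix $A$ has eigenvalues $\lambda_1,\ldots,\lambda_n$ and orthonormal eigenvectors $v_1,\ldots,v_n$, with $Av_i=\lambda_iv_i$. Its eigendecomposition is written $A=V_1\Lambda_1V_1^*+V_2\Lambda_2V_2^*$, where $V_1=[v_1\ \cdots\ v_m]$, $V_2=[v_{m+1}\ \cdots\ v_n]$, $\Lambda_1=\mathrm{diag}(\lambda_1,\ldots,\lambda_m)$ contains the target eigenvalues and $\Lambda_2=\mathrm{diag}(\lambda_{m+1},\ldots,\lambda_n)$ the unwanted ones. The rational filter with weights $\omega_j$ and poles $z_j$ is $r(\lambda)=\sum_{j=1}^{\ell}\omega_j(z_j-\lambda)^{-1}$, with matrix form $r(A)=\sum_{j=1}^{\ell}\omega_j(z_jI-A)^{-1}$. All $r(\lambda_i)$ are nonzero, and the eigenvalues are indexed so that $$|r(\lambda_1)|\ge\cdots\ge|r(\lambda_m)|>|r(\lambda_{m+1})|\ge\cdots\ge|r(\lambda_n)|.$$ There is a single dangerous eigenvalue, $\lambda_1$, located at distance $d\ll1$ from the nearest pole $z_{j_*}$: $z_{j_*}-\lambda_1=de^{i\theta}$ with $0\le\theta<2\pi$. The weight of this pole is normalized to $\omega_{j_*}=1$. Asymptotic statements refer to the limit $d\to0$. *)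

(* Defs.v *)
From mathcomp Require Export all_boot all_order all_algebra complex.
From mathcomp Require Export all_classical all_reals all_analysis.
Export Order.TTheory GRing.Theory Num.Theory numFieldNormedType.Exports.

Set Implicit Arguments.
Unset Strict Implicit.
Unset Printing Implicit Defensive.

Local Open Scope ring_scope.
Local Open Scope complex_scope.
Local Open Scope sesquilinear_scope.

(* The modulus of a complex number as a real number (the library norm `|x| of
   x : R[i] is itself an element of R[i]). *)
Definition cmod (R : realType) (x : R[i]) : R := ComplexField.Normc.normc x.

(* Euclidean norm; only meant for row or column vectors. *)
Definition enorm (R : realType) (m n : nat) (u : 'M[R[i]]_(m, n)) : R :=
  Num.sqrt (\sum_(i < m) \sum_(j < n) cmod (u i j) ^+ 2).

(* The square roots of the eigenvalues of A^* A, with multiplicity and in no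
   particular order. The eigenvalues, which are real, are given by the library
   as complex numbers, hence complex.Re. When n <= m these are the usual n
   singular values of A; when m < n there are n - m additional zeros. *)
Definition singular_value (R : realType) (m n : nat) (A : 'M[R[i]]_(m, n))
    (i : 'I_n) : R :=
  Num.sqrt (complex.Re (spectral_diag (A ^t* *m A) 0 i)).

Definition sigma_max (R : realType) (m n : nat) (A : 'M[R[i]]_(m, n)) : R :=
  \big[Num.max/0]_(i < n) singular_value A i.

Definition sigma_min (R : realType) (m n : nat) (A : 'M[R[i]]_(m, n.+1)) : R :=
  \big[Num.min/singular_value A ord0]_(i < n.+1) singular_value A i.

Definition spectral_norm (R : realType) (m n : nat) (A : 'M[R[i]]_(m, n)) : R :=
  sigma_max A.

(* For n < m (at least as many rows as columns). Division by zero being zero in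
   MathComp, the condition number of a rank deficient matrix has to be set to
   +oo explicitly. *)
Definition cond_number (R : realType) (m n : nat) (A : 'M[R[i]]_(m, n.+1)) :
    \bar R :=
  if sigma_min A == 0 then +oo%E else (sigma_max A / sigma_min A)%:E.

Definition ratfilter (R : realType) (l : nat) (w z : 'I_l -> R[i]) (x : R[i]) :
    R[i] :=
  \sum_(j < l) w j * (z j - x)^-1.

Definition ratfilter_mx (R : realType) (l n : nat) (w z : 'I_l -> R[i])
    (A : 'M[R[i]]_n) : 'M[R[i]]_n :=
  \sum_(j < l) w j *: invmx ((z j)%:M - A).

(* In what follows m = p.+1 is the number of target eigenvalues and
   n = p.+1 + k.+1, so that the number of unwanted ones is k.+1. Indices start
   from 0: lambda_1, lambda_2, lambda_m are the entries idx1, idx2, idxm of lam.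
   If m = 1 then lambda_2 is the first unwanted eigenvalue, and b, D are empty
   (spectral_norm of an empty matrix is 0). *)

Definition idx1 (p k : nat) : 'I_(p.+1 + k.+1) := lshift k.+1 ord0.
Definition idx2 (p k : nat) : 'I_(p.+1 + k.+1) := inord 1.
Definition idxm (p k : nat) : 'I_(p.+1 + k.+1) := lshift k.+1 ord_max.

Record dangerous_filter (R : realType) (p k l : nat)
    (A V : 'M[R[i]]_(p.+1 + k.+1)) (lam : 'rV[R[i]]_(p.+1 + k.+1))
    (w z : 'I_l -> R[i]) (js : 'I_l) (theta d : R) : Prop := DangerousFilter {
  df_normal : A \is normalmx;
  df_orthonormal : V ^t* *m V = 1%:M;
  df_eigen : A *m V = V *m diag_mx lam;
  df_neq0 : forall i, ratfilter w z (lam 0 i) != 0;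
  df_order : forall i j : 'I_(p.+1 + k.+1), (i <= j)%N ->
    cmod (ratfilter w z (lam 0 j)) <= cmod (ratfilter w z (lam 0 i));
  df_gap : forall i j : 'I_(p.+1 + k.+1), (i < p.+1)%N -> (p.+1 <= j)%N ->
    cmod (ratfilter w z (lam 0 j)) < cmod (ratfilter w z (lam 0 i));
  df_theta : 0 <= theta < 2 * pi;
  df_dist : z js - lam 0 (idx1 p k) = d%:C * (cos theta +i* sin theta);
  df_nearest : forall j, d <= cmod (z j - lam 0 (idx1 p k));
  df_weight : w js = 1
}.

(* lambda_1 is the only dangerous eigenvalue: with bounds W, delta, mu meant to
   be independent of d, the weights are at most W, every eigenvalue-pole pair
   other than (lambda_1, z_js) is at distance at least delta, and the nonzero
   values of the filter at the eigenvalues do not degenerate as d -> 0. *)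
Record single_danger (R : realType) (p k l : nat)
    (lam : 'rV[R[i]]_(p.+1 + k.+1)) (w z : 'I_l -> R[i]) (js : 'I_l)
    (W delta mu : R) : Prop := SingleDanger {
  sd_weights : forall j, cmod (w j) <= W;
  sd_sep : forall i j, (i, j) != (idx1 p k, js) ->
    delta <= cmod (z j - lam 0 i);
  sd_neq0 : forall i, mu <= cmod (ratfilter w z (lam 0 i))
}.

Definition targetV (R : realType) (p k : nat) (V : 'M[R[i]]_(p.+1 + k.+1)) :
    'M[R[i]]_(p.+1 + k.+1, p.+1) :=
  lsubmx V.

Definition blockb (R : realType) (p k : nat) (V : 'M[R[i]]_(p.+1 + k.+1))
    (Q : 'M[R[i]]_(p.+1 + k.+1, p.+1)) : 'rV[R[i]]_p :=
  (col ord0 (targetV V)) ^t* *m col' ord0 Q.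

Definition blockD (R : realType) (p k : nat) (V : 'M[R[i]]_(p.+1 + k.+1))
    (Q : 'M[R[i]]_(p.+1 + k.+1, p.+1)) : 'M[R[i]]_p :=
  (col' ord0 (targetV V)) ^t* *m col' ord0 Q.

Definition scalingT (R : realType) (p : nat) (r1 : R[i]) : 'M[R[i]]_p.+1 :=
  diag_mx (\row_(j < p.+1) if j == ord0 then r1^-1 else 1).

(* Main.v *)
Require Import Defs.
From mathcomp Require Import ring lra.

(** For a vector x with first entry xi and remaining entries y, the vector
    X2 T x has, in the orthonormal eigenbasis V, the coordinates
      [i = 1] xi + r_i t_i + (xi / r_1) r_i g_i,
    where r_i is the filter value at the i-th eigenvalue and t, g are the
    coordinates of Q' y (Q' being Q without its first column q_1) and of
    q_1 - v_1. As r_1 is the largest value, the g-term has norm at most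
    eps |xi| with eps = ||q_1 - v_1|| = O(d), although q_1 is not exactly
    v_1. Moreover t has the norm of y, its entry at v_1 is b y, and its
    entries at v_2, ..., v_m form D y. Also q_1 is orthogonal to Q', so
    b = (v_1 - q_1)^* Q' and ||b|| <= eps ([blockb_le]).

    The extreme singular values are extreme stretching factors
    ([cond_number_le]), so it suffices to bound the norm of these coordinates
    from both sides in terms of ||x||.
    - From above ([filtered_vector_le]): apart from the entry r_1 (b y),
      the first two terms are a diagonal scaling of (xi, t) by factors at most
      max(1, |r_2|), whence the factor max(1, |r_2|) + |r_1| ||b|| + eps.
    - From below ([le_filtered_vector]): let h be the norm of the first two
      terms. If ||y|| <= N h, then xi, being the first entry minus r_1 (b y),
      satisfies |xi| <= h + |r_1| ||b|| N h, so ||x|| <= K h with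
      K = 1 + (|r_1| ||b|| + 1) N, and the g-term changes 1 / K into
      (1 - K eps) / K.
    Since r_1 is 1 / d up to a phase and a bounded term, |r_1| ||b|| is
    ||b|| / d + O(d), and the quotient of the two factors is the claimed bound.

    The point that needs care is that the remainder must be O(d) although
    ||D^-1|| may blow up as d tends to 0: the correction 1 / (1 - K eps) is
    1 + O(d) only when K is bounded. Two values of N are available. The entries
    D y of t give N = ||D^-1|| / |r_m| ([le_leading_part_sub]), the one in the
    claim. But ||t|| = ||y||, only the small part b y of t is mixed with xi,
    and no |r_i| is below mu, so that N = 2 / mu works too
    ([le_leading_part_tail]). Taking the minimum of both keeps K bounded, and
    [asymptotic_bound] then collects all errors in a constant multiple of d. *)

Set Implicit Arguments.
Unset Strict Implicit.
Unset Printing Implicit Defensive.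

Local Open Scope classical_set_scope.
Local Open Scope ring_scope.
Local Open Scope complex_scope.
Local Open Scope sesquilinear_scope.

(** * Modulus and Euclidean norm *)

Section Modulus.
Variable R : realType.
Implicit Types x y : R[i].

Lemma cmodE x : (cmod x)%:C = `|x|.
Proof. by case: x. Qed.

Lemma cmod_ge0 x : 0 <= cmod x.
Proof. by rewrite -ler0c cmodE. Qed.

Lemma cmodM x y : cmod (x * y) = cmod x * cmod y.
Proof. exact: ComplexField.Normc.normcM. Qed.

Lemma cmodV x : cmod x^-1 = (cmod x)^-1.
Proof. exact: ComplexField.Normc.normcV. Qed.

Lemma cmod0 : cmod (0 : R[i]) = 0.
Proof. exact: ComplexField.Normc.normc0. Qed.

Lemma cmod1 : cmod (1 : R[i]) = 1.
Proof. exact: ComplexField.Normc.normc1. Qed.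

Lemma cmod_eq0 x : (cmod x == 0) = (x == 0).
Proof.
by apply/eqP/eqP => [/ComplexField.Normc.eq0_normc//|->]; exact: cmod0.
Qed.

Lemma cmod_gt0 x : (0 < cmod x) = (x != 0).
Proof. by rewrite lt_def cmod_eq0 cmod_ge0 andbT. Qed.

Lemma cmodN x : cmod (- x) = cmod x.
Proof. by apply: complexI; rewrite !cmodE normrN. Qed.

Lemma cmodD x y : cmod (x + y) <= cmod x + cmod y.
Proof. by rewrite -lecR rmorphD /= !cmodE ler_normD. Qed.

Lemma cmod_sum (I : finType) (P : pred I) (F : I -> R[i]) :
  cmod (\sum_(i | P i) F i) <= \sum_(i | P i) cmod (F i).
Proof.
elim/big_rec2: _ => [|i a b _ ab]; first by rewrite cmod0.
by apply: le_trans (cmodD _ _) _; rewrite lerD2l.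
Qed.

Lemma cmod_sqr x : (cmod x ^+ 2)%:C = x^* * x.
Proof. by rewrite rmorphXn /= cmodE sqr_normc mulrC. Qed.

End Modulus.

Section Enorm.
Variable R : realType.
Local Notation C := R[i].

Lemma enorm_ge0 m n (u : 'M[C]_(m, n)) : 0 <= enorm u.
Proof. exact: sqrtr_ge0. Qed.

Lemma enorm_sqr n (u : 'cV[C]_n) : enorm u ^+ 2 = \sum_i cmod (u i 0) ^+ 2.
Proof.
rewrite sqr_sqrtr.
  by apply: eq_bigr => i _; rewrite big_ord1.
by apply: sumr_ge0 => i _; apply: sumr_ge0 => j _; rewrite sqr_ge0.
Qed.

Lemma enorm_delta n (i : 'I_n) : enorm (delta_mx i 0 : 'cV[C]_n) = 1.
Proof.
apply/eqP; rewrite -(eqrXn2 (n := 2)) ?enorm_ge0 ?ler01// enorm_sqr.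
rewrite (bigD1 i)//= mxE !eqxx cmod1 big1 ?addr0// => j ji.
by rewrite mxE (negPf ji) cmod0 expr0n.
Qed.

Lemma enorm_tr m n (u : 'M[C]_(m, n)) : enorm u^T = enorm u.
Proof.
congr Num.sqrt; rewrite exchange_big; apply: eq_bigr => i _.
by apply: eq_bigr => j _; rewrite mxE.
Qed.

Lemma enorm_trC m n (u : 'M[C]_(m, n)) : enorm (u ^t*) = enorm u.
Proof.
rewrite -[RHS]enorm_tr; congr Num.sqrt.
apply: eq_bigr => i _; apply: eq_bigr => j _; rewrite !mxE.
by congr (_ ^+ 2); apply: complexI; rewrite !cmodE norm_conjC.
Qed.

Lemma enorm_gram n (u : 'cV[C]_n) : (enorm u ^+ 2)%:C = (u ^t* *m u) 0 0.
Proof.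
rewrite enorm_sqr rmorph_sum mxE; apply: eq_bigr => i _.
by rewrite !mxE /= cmod_sqr.
Qed.

Lemma enorm_isometry m n (A : 'M[C]_(m, n)) (u : 'cV[C]_n) :
  A ^t* *m A = 1%:M -> enorm (A *m u) = enorm u.
Proof.
move=> AA; apply/eqP; rewrite -(eqrXn2 (n := 2)) ?enorm_ge0//.
apply/eqP/complexI; rewrite !enorm_gram trmx_mul map_mxM.
by rewrite mulmxA -[_ *m A]mulmxA AA mulmx1.
Qed.

Lemma enorm_dot n (u : 'cV[C]_n) : (enorm u)%:C = sqrtC (dotmx u^T u^T).
Proof.
rewrite -[LHS](sqrCK (x := (enorm u)%:C)) ?ler0c ?enorm_ge0//.
congr sqrtC; rewrite -rmorphXn /= enorm_sqr rmorph_sum dotmxE mxE.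
by apply: eq_bigr => i _; rewrite !mxE /= cmod_sqr mulrC.
Qed.

Lemma enormD n (u v : 'cV[C]_n) : enorm (u + v) <= enorm u + enorm v.
Proof.
rewrite -lecR rmorphD /= !enorm_dot linearD /=.
exact: (triangle_lerif (@dotmx C n) u^T v^T).1.
Qed.

(** The Cauchy-Schwarz inequality. *)
Lemma cmod_mulmx_le n (b : 'rV[C]_n) (y : 'cV[C]_n) :
  cmod ((b *m y) 0 0) <= enorm b * enorm y.
Proof.
rewrite -lecR rmorphM /= cmodE -[enorm b]enorm_tr -[enorm y]enorm_trC.
rewrite -[enorm (y ^t*)]enorm_tr !enorm_dot !trmxK.
rewrite -[in X in `|X|](trmxCK y) -dotmxE.
exact: (CauchySchwarz_sqrt (@dotmx C n) b (y ^t*)).1.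
Qed.

Lemma enormZ n (a : C) (u : 'cV[C]_n) : enorm (a *: u) = cmod a * enorm u.
Proof.
apply/eqP; rewrite -(eqrXn2 (n := 2)) ?mulr_ge0 ?enorm_ge0 ?cmod_ge0//.
rewrite exprMn !enorm_sqr mulr_sumr; apply/eqP/eq_bigr => i _.
by rewrite mxE cmodM exprMn.
Qed.

(** The map [f] makes this cover subvectors and single entries as well as
    entrywise comparison of vectors of the same size. *)
Lemma le_enorm m n (f : 'I_m -> 'I_n) (c : R) (u : 'cV[C]_m) (v : 'cV[C]_n) :
  injective f -> 0 <= c ->
  (forall i, cmod (u i 0) <= c * cmod (v (f i) 0)) -> enorm u <= c * enorm v.
Proof.
move=> f_inj c0 uv; rewrite -(ler_pXn2r (n := 2)) ?nnegrE ?mulr_ge0 ?enorm_ge0//.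
rewrite exprMn !enorm_sqr mulr_sumr.
apply: (@le_trans _ _ (\sum_i (c * cmod (v (f i) 0)) ^+ 2)).
  apply: ler_sum => i _.
  by rewrite ler_pXn2r ?nnegrE ?mulr_ge0 ?cmod_ge0.
rewrite -(big_imset (h := f) (fun j => (c * cmod (v j 0)) ^+ 2)) /=; last first.
  by move=> i j _ _ /f_inj.
rewrite big_mkcond; apply: ler_sum => j _.
by rewrite -exprMn; case: ifP => // _; exact: sqr_ge0.
Qed.

Lemma cmod_le_enorm n (u : 'cV[C]_n) i : cmod (u i 0) <= enorm u.
Proof.
rewrite -(ler_pXn2r (n := 2)) ?nnegrE ?cmod_ge0 ?enorm_ge0//.
by rewrite enorm_sqr (bigD1 i)//= lerDl sumr_ge0// => j _; rewrite sqr_ge0.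
Qed.

Lemma enorm_split p (x : 'cV[C]_p.+1) :
  enorm x ^+ 2 = cmod (x 0 0) ^+ 2 + enorm (row' 0 x) ^+ 2.
Proof.
rewrite !enorm_sqr big_ord_recl; congr (_ + _).
by apply: eq_bigr => i _; rewrite mxE.
Qed.

Lemma mulmx_split m p (A : 'M[C]_(m, p.+1)) (x : 'cV[C]_p.+1) :
  A *m x = x 0 0 *: col 0 A + col' 0 A *m row' 0 x.
Proof.
apply/colP => i; rewrite !mxE big_ord_recl mulrC; congr (_ + _).
by apply: eq_bigr => j _; rewrite !mxE.
Qed.

End Enorm.

(** Pairing u with P P^t* u, a vector as long as P^t* u, gives the square of
    the norm of P^t* u, so Cauchy-Schwarz applies. *)
Lemma enorm_coisometry_le (R : realType) m n (P : 'M[R[i]]_(m, n))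
    (u : 'cV[R[i]]_m) :
  P ^t* *m P = 1%:M -> enorm (P ^t* *m u) <= enorm u.
Proof.
move=> PP; set v := P ^t* *m u.
have [->|v0] := eqVneq (enorm v) 0; first exact: enorm_ge0.
have vp : 0 < enorm v by rewrite lt_def v0 enorm_ge0.
rewrite -(ler_pM2r vp) -expr2 -[in leRHS](enorm_isometry v PP) -[enorm u]enorm_trC.
apply: le_trans (cmod_mulmx_le _ _).
have -> : u ^t* *m (P *m v) = v ^t* *m v.
  have -> : v ^t* = u ^t* *m P by rewrite trmx_mul map_mxM trmxCK.
  by rewrite mulmxA.
by rewrite -enorm_gram -lecR cmodE ger0_norm// ler0c sqr_ge0.
Qed.

Lemma orthonormal_col' (R : realType) m p (Q : 'M[R[i]]_(m, p.+1)) :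
  Q ^t* *m Q = 1%:M -> (col' 0 Q) ^t* *m col' 0 Q = 1%:M.
Proof.
move=> QQ; apply/matrixP => i j.
have /matrixP/(_ (lift 0 i) (lift 0 j)) := QQ.
rewrite !mxE (inj_eq lift_inj) => <-.
by apply: eq_bigr => a _; rewrite !mxE.
Qed.

(** * Singular values as extremal stretching factors *)

Section SingularValues.
Variable R : realType.
Local Notation C := R[i].
Variables m n : nat.
Variable A : 'M[C]_(m, n).

Let P := spectralmx (A ^t* *m A).

Let PP : P *m P ^t* = 1%:M.
Proof. exact/unitarymxP/spectral_unitarymx. Qed.

Let gramE : A ^t* *m A = P ^t* *m diag_mx (spectral_diag (A ^t* *m A)) *m P.
Proof.
rewrite -[P ^t*]invmx_unitary ?spectral_unitarymx//; apply/orthomx_spectralP.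
by apply/normalmxP; rewrite trmx_mul map_mxM trmxCK.
Qed.

Lemma enorm_mulmx_gram (x : 'cV[C]_n) :
  (enorm (A *m x) ^+ 2)%:C =
  \sum_i spectral_diag (A ^t* *m A) 0 i * (cmod ((P *m x) i 0) ^+ 2)%:C.
Proof.
rewrite enorm_gram trmx_mul map_mxM mulmxA -[_ *m A]mulmxA [in LHS]gramE.
rewrite -!mulmxA mulmxA -map_mxM -trmx_mul mxE; apply: eq_bigr => i _.
by rewrite mul_diag_mx !mxE /= cmod_sqr mulrCA.
Qed.

Lemma spectral_diag_gram (i : 'I_n) :
  exists2 u : 'cV[C]_n, enorm u = 1 &
    spectral_diag (A ^t* *m A) 0 i = (enorm (A *m u) ^+ 2)%:C.
Proof.
pose e : 'cV[C]_n := delta_mx i 0; pose u := P ^t* *m e.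
have Pu : P *m u = e by rewrite mulmxA PP mul1mx.
exists u.
  by rewrite enorm_isometry ?trmxCK// enorm_delta.
rewrite enorm_mulmx_gram Pu (bigD1 i)//= mxE !eqxx cmod1 expr1n mulr1.
rewrite big1 ?addr0// => j ji.
by rewrite mxE (negPf ji) cmod0 expr0n mulr0.
Qed.

(** The eigenvectors of the Gram matrix are right singular vectors. *)
Lemma singular_vector (i : 'I_n) :
  exists2 u : 'cV[C]_n, enorm u = 1 & singular_value A i = enorm (A *m u).
Proof.
have [u u1 su] := spectral_diag_gram i; exists u => //.
by rewrite /singular_value su sqrtr_sqr ger0_norm// enorm_ge0.
Qed.

Lemma singular_value_ge0 i : 0 <= singular_value A i.
Proof. exact: sqrtr_ge0. Qed.

(** In the orthonormal basis given by the rows of the spectral matrix P of the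
    Gram matrix, A acts as a weighting of the coordinates. *)
Lemma enorm_mulmx_singular (x : 'cV[C]_n) :
  enorm (A *m x) ^+ 2 =
  \sum_i singular_value A i ^+ 2 * cmod ((P *m x) i 0) ^+ 2.
Proof.
apply: complexI; rewrite enorm_mulmx_gram rmorph_sum; apply: eq_bigr => i _.
rewrite [RHS]rmorphM; congr (_ * _).
have [u _ su] := spectral_diag_gram i.
rewrite /singular_value su -[complex.Re _]/(enorm (A *m u) ^+ 2).
by rewrite sqrtr_sqr ger0_norm// enorm_ge0.
Qed.

Lemma singular_value_le i : singular_value A i <= sigma_max A.
Proof. by rewrite /sigma_max (bigmax_sup i). Qed.

Lemma sigma_max_ge0 : 0 <= sigma_max A.
Proof. exact: bigmax_ge_id. Qed.

Lemma enorm_mulmx_le (x : 'cV[C]_n) : enorm (A *m x) <= sigma_max A * enorm x.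
Proof.
have -> : enorm x = enorm (P *m x).
  by rewrite enorm_isometry//; apply: mulmx1C.
rewrite -(ler_pXn2r (n := 2)) ?nnegrE ?mulr_ge0 ?enorm_ge0 ?sigma_max_ge0//.
rewrite exprMn enorm_mulmx_singular enorm_sqr mulr_sumr.
apply: ler_sum => i _; rewrite ler_wpM2r ?sqr_ge0//.
by rewrite ler_pXn2r ?nnegrE ?sigma_max_ge0 ?singular_value_ge0 ?singular_value_le.
Qed.

Lemma sigma_max_le (c : R) : 0 <= c ->
  (forall x : 'cV[C]_n, enorm (A *m x) <= c * enorm x) -> sigma_max A <= c.
Proof.
move=> c0 Ac; apply: bigmax_le => // i _.
by have [u u1 ->] := singular_vector i; rewrite (le_trans (Ac u))// u1 mulr1.
Qed.

End SingularValues.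

Lemma le_sigma_min (R : realType) (m n : nat) (A : 'M[R[i]]_(m, n.+1)) (c : R) :
  (forall x : 'cV[R[i]]_n.+1, c * enorm x <= enorm (A *m x)) ->
  c <= sigma_min A.
Proof.
move=> cA; have cs i : c <= singular_value A i.
  by have [u u1 ->] := singular_vector A i; rewrite (le_trans _ (cA u))// u1 mulr1.
exact: le_bigmin.
Qed.

(** A positive lower factor also excludes the infinite value that
    [cond_number] takes on rank deficient matrices. *)
Lemma cond_number_le (R : realType) (m n : nat) (A : 'M[R[i]]_(m, n.+1))
    (s c : R) :
  0 < c ->
  (forall x : 'cV[R[i]]_n.+1, enorm (A *m x) <= s * enorm x) ->
  (forall x : 'cV[R[i]]_n.+1, c * enorm x <= enorm (A *m x)) ->
  (cond_number A <= (s / c)%:E)%E.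
Proof.
move=> c0 As Ac; have s0 : 0 <= s.
  have [u u1 _] := singular_vector A ord0.
  by have := As u; rewrite u1 mulr1; apply: le_trans; rewrite enorm_ge0.
have cs := le_sigma_min Ac; have sp := lt_le_trans c0 cs.
rewrite /cond_number gt_eqF// lee_fin.
apply: ler_pM; [exact: sigma_max_ge0| by rewrite invr_ge0 ltW|
  exact: sigma_max_le|by rewrite lef_pV2 // posrE].
Qed.

(** * The rational filter in the eigenbasis *)

Section RationalFilter.
Variable R : realType.
Local Notation C := R[i].
Variables (n l : nat) (A V : 'M[C]_n) (lam : 'rV[C]_n) (w z : 'I_l -> C).
Hypothesis VV : V ^t* *m V = 1%:M.
Hypothesis AV : A *m V = V *m diag_mx lam.
Hypothesis poles : forall i j, z j != lam 0 i.

(** The candidate inverse is V diag(1 / (z_j - lam_i)) V^t*; it is defined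
    because no pole meets the spectrum. *)
Lemma invmx_shift_diag (j : 'I_l) :
  V ^t* *m invmx ((z j)%:M - A) =
  diag_mx (\row_i (z j - lam 0 i)^-1) *m V ^t*.
Proof.
set S := _ - A; set E := diag_mx _.
have SV : S *m V *m E = V.
  rewrite /S mulmxBl AV mul_scalar_mx -mul_mx_scalar -mulmxBr -mulmxA.
  rewrite -[RHS]mulmx1; congr (_ *m _).
  apply/matrixP => i i'; rewrite mul_mx_diag !mxE.
  case: (eqVneq i i') => [<-|_]; last by rewrite !mulr0n subr0 mul0r.
  by rewrite !mulr1n mulfV// subr_eq0.
have VV' : V *m V ^t* = 1%:M by apply: mulmx1C.
have SB : S *m (V *m E *m V ^t*) = 1%:M by rewrite !mulmxA SV.
have [Su _] := mulmx1_unit SB.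
by rewrite -[invmx S]mulmx1 -SB mulKmx// !mulmxA VV mul1mx.
Qed.

Lemma ratfilter_mx_diag :
  V ^t* *m ratfilter_mx w z A =
  diag_mx (\row_i ratfilter w z (lam 0 i)) *m V ^t*.
Proof.
rewrite mulmx_sumr; apply/matrixP => a c; rewrite mul_diag_mx !mxE summxE.
rewrite mulr_suml; apply: eq_bigr => j _.
by rewrite -scalemxAr invmx_shift_diag mxE mul_diag_mx !mxE mulrA.
Qed.

End RationalFilter.

Section FilterValues.
Variable R : realType.
Variables (l : nat) (w z : 'I_l -> R[i]) (W delta : R).
Hypothesis delta_gt0 : 0 < delta.
Hypothesis wW : forall j, cmod (w j) <= W.

Lemma ratfilter_partial_le (P : pred 'I_l) (x : R[i]) :
  (forall j, P j -> delta <= cmod (z j - x)) ->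
  cmod (\sum_(j | P j) w j * (z j - x)^-1) <= l%:R * (W / delta).
Proof.
move=> sep; apply: le_trans (cmod_sum _ _) _.
have -> : l%:R * (W / delta) = \sum_(j < l) W / delta.
  by rewrite sumr_const card_ord mulr_natl.
rewrite big_mkcond; apply: ler_sum => j _; have := wW j => Wj.
have W0 : 0 <= W := le_trans (cmod_ge0 _) Wj.
case: ifP => [Pj|_]; last by rewrite mulr_ge0// invr_ge0 ltW.
have dj := sep j Pj.
rewrite cmodM cmodV ler_pM ?invr_ge0 ?cmod_ge0//.
by rewrite lef_pV2// posrE// (lt_le_trans delta_gt0).
Qed.

(** The pole at distance d, of weight 1, contributes exactly 1 / d in modulus;
    the others are covered by the separation. *)
Lemma ratfilter_near_pole_le (js : 'I_l) (x : R[i]) (d : R) :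
  w js = 1 -> cmod (z js - x) = d ->
  (forall j, j != js -> delta <= cmod (z j - x)) ->
  cmod (ratfilter w z x) <= d^-1 + l%:R * (W / delta).
Proof.
move=> w1 zd sep; rewrite /ratfilter (bigD1 js)//=.
apply: le_trans (cmodD _ _) _; apply: lerD; last exact: ratfilter_partial_le.
by rewrite w1 mul1r cmodV zd.
Qed.

End FilterValues.

Lemma cmod_polar (R : realType) (d theta : R) : 0 <= d ->
  cmod (d%:C * (cos theta +i* sin theta)) = d.
Proof.
move=> d0; rewrite cmodM /cmod /= cos2Dsin2 sqrtr1 mulr1.
by rewrite expr0n /= addr0 sqrtr_sqr ger0_norm.
Qed.

(** * Coordinates of a filtered vector *)

Section Core.
Variable R : realType.
Local Notation C := R[i].
Variables (n : nat) (i1 : 'I_n) (rho : 'I_n -> C) (xi : C) (t g : 'cV[C]_n).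

(** The eigenbasis coordinates of X2 T x if the first column of Q were exactly
    v_1; t stands for the coordinates of the combination of the other columns.
    The filter value [rho i1] does not multiply xi because T divides it out. *)
Definition leading_part : 'cV[C]_n :=
  \col_i ((i == i1)%:R * xi + rho i * t i 0).

(** The coordinates of X2 T x for the actual first column, which differs from
    v_1 by a vector with coordinates g. *)
Definition filtered_vector : 'cV[C]_n :=
  \col_i (leading_part i 0 + xi / rho i1 * (rho i * g i 0)).

Let pert : 'cV[C]_n := \col_i (xi / rho i1 * (rho i * g i 0)).

Let filteredE : filtered_vector = leading_part + pert.
Proof. by apply/colP => i; rewrite !mxE. Qed.

Variables (m2 s eps X : R).
Hypothesis rho1 : rho i1 != 0.
Hypothesis rho_max : forall i, cmod (rho i) <= cmod (rho i1).
Hypothesis t1 : cmod (t i1 0) <= s * enorm t.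
Hypothesis g_eps : enorm g <= eps.
Hypothesis X0 : 0 <= X.
Hypothesis XE : X ^+ 2 = cmod xi ^+ 2 + enorm t ^+ 2.
Hypothesis s0 : 0 <= s.

Let xiX : cmod xi <= X.
Proof.
rewrite -(ler_pXn2r (n := 2)) ?nnegrE ?cmod_ge0//.
by rewrite XE lerDl sqr_ge0.
Qed.

Let tX : enorm t <= X.
Proof.
rewrite -(ler_pXn2r (n := 2)) ?nnegrE ?enorm_ge0//.
by rewrite XE lerDr sqr_ge0.
Qed.

(* Dividing by the largest filter value compensates the filtering of g. *)
Let pert_le : enorm pert <= eps * X.
Proof.
apply: (@le_trans _ _ (cmod xi * enorm g)).
  apply: (@le_enorm _ _ _ id) => //; first exact: cmod_ge0.
  move=> i; rewrite mxE !cmodM cmodV -mulrA ler_wpM2l ?cmod_ge0//.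
  have r0 : 0 < cmod (rho i1) by rewrite cmod_gt0.
  rewrite mulrA ler_piMl ?cmod_ge0// mulrC ler_pdivrMr// mul1r.
  exact: rho_max.
by rewrite mulrC ler_pM ?cmod_ge0 ?enorm_ge0.
Qed.

(** The dominant value [rho i1] meets t only in the entry [t i1 0], which is
    small; every other entry of t is scaled by at most m2. *)
Lemma filtered_vector_le :
    1 <= m2 -> (forall i, i != i1 -> cmod (rho i) <= m2) ->
  enorm filtered_vector <= (m2 + cmod (rho i1) * s + eps) * X.
Proof.
move=> m21 rho_m2.
have m20 : 0 <= m2 by apply: le_trans m21.
(* u is a diagonal scaling of (xi, t) and v isolates the dominant entry. *)
pose u : 'cV[C]_n := \col_i if i == i1 then xi else rho i * t i 0.
pose v : 'cV[C]_n := (rho i1 * t i1 0) *: delta_mx i1 0.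
have -> : filtered_vector = u + v + pert.
  rewrite filteredE; congr (_ + _); apply/colP => i; rewrite !mxE eqxx andbT.
  case: eqP => [->|_]; first by rewrite mul1r mulr1.
  by rewrite mul0r add0r mulr0 addr0.
have u_le : enorm u <= m2 * X.
  rewrite -(ler_pXn2r (n := 2)) ?nnegrE ?enorm_ge0 ?mulr_ge0//.
  rewrite exprMn XE !enorm_sqr (bigD1 i1)//= [in leRHS](bigD1 i1)//= mxE eqxx.
  have m2sq : 1 <= m2 ^+ 2 by rewrite expr_ge1.
  rewrite mulrDr; apply: lerD; first by rewrite ler_peMl ?sqr_ge0.
  rewrite mulrDr; apply: ler_wpDl; first by rewrite mulr_ge0 ?sqr_ge0.
  rewrite mulr_sumr; apply: ler_sum => i ii1; rewrite mxE (negPf ii1).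
  rewrite cmodM exprMn ler_wpM2r ?sqr_ge0//.
  by rewrite ler_pXn2r ?nnegrE ?cmod_ge0// rho_m2.
have v_le : enorm v <= cmod (rho i1) * s * X.
  rewrite enormZ enorm_delta mulr1 cmodM -mulrA ler_wpM2l ?cmod_ge0//.
  by apply: (le_trans t1); rewrite ler_wpM2l.
rewrite 2!mulrDl; apply: le_trans (enormD _ _) _; apply: lerD => //.
by apply: le_trans (enormD _ _) _; apply: lerD.
Qed.

(** The constant N says how well t is controlled by the leading part; xi is
    then recovered from the entry i1, from which [rho i1 * t i1 0] has to be
    subtracted, and this gives K. *)
Lemma le_filtered_vector (N : R) : 0 <= N ->
  enorm t <= N * enorm leading_part ->
  let K := 1 + (cmod (rho i1) * s + 1) * N in
  (1 - K * eps) / K * X <= enorm filtered_vector.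
Proof.
set K := 1 + _; set h := enorm leading_part => N0 tN /=.
have h0 : 0 <= h by exact: enorm_ge0.
have a0 : 0 <= cmod (rho i1) * s by rewrite mulr_ge0 ?cmod_ge0.
have K0 : 0 < K by rewrite /K ltr_pwDl// mulr_ge0// addr_ge0.
have xi_le : cmod xi <= h + cmod (rho i1) * s * enorm t.
  have -> : xi = leading_part i1 0 + - (rho i1 * t i1 0).
    by rewrite mxE eqxx mul1r addrK.
  apply: le_trans (cmodD _ _) _; apply: lerD; first exact: cmod_le_enorm.
  by rewrite cmodN cmodM -mulrA ler_wpM2l ?cmod_ge0.
have XK : X <= K * h.
  apply: (@le_trans _ _ (cmod xi + enorm t)).
    rewrite -(ler_pXn2r (n := 2)) ?nnegrE ?addr_ge0 ?cmod_ge0 ?enorm_ge0//.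
    rewrite XE sqrrD -addrA lerD2l lerDr.
    by rewrite mulrn_wge0// mulr_ge0 ?cmod_ge0 ?enorm_ge0.
  have := ler_wpM2l a0 tN; rewrite /K; lra.
have hf : h <= enorm filtered_vector + eps * X.
  have -> : h = enorm (filtered_vector + (-1) *: pert).
    by rewrite scaleN1r filteredE addrK.
  apply: le_trans (enormD _ _) _.
  by rewrite lerD2l enormZ cmodN cmod1 mul1r.
rewrite mulrAC ler_pdivrMr//.
have := ler_wpM2l (ltW K0) hf; lra.
Qed.

(** Every entry of t but [t i1 0] occurs in the leading part, multiplied by a
    filter value of modulus at least mu, and [t i1 0] carries at most half of
    the norm of t. This bound is independent of D, hence uniform in d. *)
Lemma le_leading_part_tail (mu : R) : 0 < mu -> s <= 2^-1 ->
  (forall i, mu <= cmod (rho i)) -> enorm t <= 2 / mu * enorm leading_part.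
Proof.
move=> mu0 s2 rho_mu.
pose tail : 'cV[C]_n := \col_i if i == i1 then 0 else t i 0.
have t_le : enorm t <= enorm tail + cmod (t i1 0).
  have -> : t = tail + t i1 0 *: delta_mx i1 0.
    apply/colP => i; rewrite !mxE eqxx andbT.
    by case: eqP => [->|_]; rewrite ?mulr1 ?add0r ?mulr0 ?addr0.
  rewrite !mxE eqxx add0r !eqxx mulr1.
  by apply: le_trans (enormD _ _) _; rewrite enormZ enorm_delta mulr1.
have tail_le : enorm tail <= mu^-1 * enorm leading_part.
  apply: (@le_enorm _ _ _ id) => //; first by rewrite invr_ge0 ltW.
  move=> i; rewrite !mxE; case: eqP => [_|_].
    by rewrite cmod0 mulr_ge0 ?cmod_ge0// invr_ge0 ltW.
  by rewrite mul0r add0r cmodM mulrA ler_peMl ?cmod_ge0// ler_pdivlMl ?mulr1.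
have := le_trans t1 (ler_wpM2r (enorm_ge0 t) s2).
lra.
Qed.

(** The indices f are those of v_2, ..., v_m: there the leading part contains
    D y scaled by filter values of modulus at least rm. *)
Lemma le_leading_part_sub p (D : 'M[C]_p) (f : 'I_p -> 'I_n) (y : 'cV[C]_p)
    (rm : R) :
  D \in unitmx -> injective f -> 0 < rm -> (forall i, f i != i1) ->
  (forall i, rm <= cmod (rho (f i))) ->
  (forall i, t (f i) 0 = (D *m y) i 0) ->
  enorm y <= spectral_norm (invmx D) / rm * enorm leading_part.
Proof.
move=> Du f_inj rm0 fi1 rho_rm tD.
have -> : enorm y = enorm (invmx D *m (D *m y)) by rewrite mulKmx.
apply: le_trans (enorm_mulmx_le _ _) _; rewrite -mulrA.
apply: ler_wpM2l; first exact: sigma_max_ge0.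
apply: (le_enorm f_inj); first by rewrite invr_ge0 ltW.
move=> i; rewrite [leading_part _ _]mxE (negPf (fi1 i)) mul0r add0r tD cmodM.
by rewrite mulrA ler_peMl ?cmod_ge0// ler_pdivlMl ?mulr1.
Qed.

End Core.

(** * The condition number at a fixed distance *)

Section FixedDistance.
Variable R : realType.
Local Notation C := R[i].
Variables (p k l : nat).
Local Notation n := (p.+1 + k.+1)%N.
Variables (A V : 'M[C]_n) (lam : 'rV[C]_n) (w z : 'I_l -> C).
Variable Q : 'M[C]_(n, p.+1).

Let r (i : 'I_n) := ratfilter w z (lam 0 i).
Let i1 := idx1 p k.
Let g := col ord0 Q - col ord0 (targetV V).
Let X2T := ratfilter_mx w z A *m Q *m scalingT p (r i1).

Hypothesis VV : V ^t* *m V = 1%:M.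
Hypothesis QQ : Q ^t* *m Q = 1%:M.

(** The first column of Q is orthogonal to the others, so v_1 may be replaced
    by its difference to that column in the definition of b. *)
Lemma blockb_le : enorm (blockb V Q) <= enorm g.
Proof.
have -> : blockb V Q = - ((col' ord0 Q) ^t* *m g) ^t*.
  apply/rowP => j; rewrite /g mulmxBr.
  have -> : (col' ord0 Q) ^t* *m col ord0 Q = 0.
    apply/colP => a; have /matrixP/(_ (lift 0 a) 0) := QQ.
    rewrite !mxE => qq; rewrite -[RHS]qq.
    by apply: eq_bigr => b _; rewrite !mxE.
  rewrite sub0r; rewrite !mxE rmorphN opprK rmorph_sum.
  by apply: eq_bigr => b _; rewrite !mxE rmorphM /= conjCK mulrC.
have -> u : enorm (- u) = enorm (u : 'rV[C]_p).
  by rewrite -enorm_tr linearN -scaleN1r enormZ cmodN cmod1 mul1r enorm_tr.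
by rewrite enorm_trC; apply/enorm_coisometry_le/orthonormal_col'.
Qed.

Hypothesis AV : A *m V = V *m diag_mx lam.
Hypothesis poles : forall i j, z j != lam 0 i.
Hypothesis r1 : r i1 != 0.

Let t (x : 'cV[C]_p.+1) := V ^t* *m (col' 0 Q *m row' 0 x).

Lemma filtered_coordinates (x : 'cV[C]_p.+1) :
  V ^t* *m (X2T *m x) = filtered_vector i1 r (x 0 0) (t x) (V ^t* *m g).
Proof.
have -> : X2T *m x = ratfilter_mx w z A *m
    ((x 0 0 / r i1) *: col 0 Q + col' 0 Q *m row' 0 x).
  rewrite /X2T -!mulmxA mul_diag_mx; congr (_ *m _).
  rewrite mulmx_split !mxE eqxx mulrC; congr (_ + _ *m _).
  by apply/colP => i; rewrite !mxE mul1r.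
have -> : col 0 Q = col 0 (targetV V) + g by rewrite /g addrC subrK.
have Vv1 : V ^t* *m col 0 (targetV V) = delta_mx i1 0.
  apply/colP => i; have /matrixP/(_ i i1) := VV; rewrite !mxE eqxx andbT => <-.
  by apply: eq_bigr => b _; rewrite !mxE.
rewrite mulmxA (ratfilter_mx_diag w VV AV poles) -mulmxA mulmxDr -scalemxAr.
rewrite [_ *m (_ + g)]mulmxDr Vv1.
rewrite -/(t x); move: (V ^t* *m g) (t x) => G tx.
apply/colP => i; rewrite mul_diag_mx !mxE eqxx andbT -/(r i).
by case: eqP => [->|_] /=; field.
Qed.

Let unitaryV : (V ^t*) ^t* *m V ^t* = 1%:M.
Proof. by rewrite trmxCK; apply: mulmx1C. Qed.

Let t_norm x : enorm (t x) = enorm (row' 0 x).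
Proof. by rewrite !enorm_isometry//; apply: orthonormal_col'. Qed.

Let t_b x : t x i1 0 = (blockb V Q *m row' 0 x) 0 0.
Proof.
by rewrite -mulmxA !mxE; apply: eq_bigr => j _; rewrite !mxE.
Qed.

Let t_D x i : t x (lshift k.+1 (lift 0 i)) 0 = (blockD V Q *m row' 0 x) i 0.
Proof.
by rewrite -mulmxA !mxE; apply: eq_bigr => j _; rewrite !mxE.
Qed.

Variables (m2 rm mu : R).
Hypothesis r_max : forall i, cmod (r i) <= cmod (r i1).
Hypothesis m2_ge1 : 1 <= m2.
Hypothesis r_m2 : forall i, i != i1 -> cmod (r i) <= m2.
Hypothesis rm_gt0 : 0 < rm.
Hypothesis r_rm : forall i : 'I_p, rm <= cmod (r (lshift k.+1 (lift 0 i))).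
Hypothesis mu_gt0 : 0 < mu.
Hypothesis r_mu : forall i, mu <= cmod (r i).
Hypothesis b_small : enorm (blockb V Q) <= 2^-1.
Hypothesis D_unit : blockD V Q \in unitmx.

Let N := Num.min (spectral_norm (invmx (blockD V Q)) / rm) (2 / mu).
Let K := 1 + (cmod (r i1) * enorm (blockb V Q) + 1) * N.

(** The minimum in N lets the bound profit from the inverse of D without
    degenerating when that inverse is large. *)
Lemma cond_number_filtered_le : K * enorm g < 1 ->
  (cond_number X2T <=
   ((m2 + cmod (r i1) * enorm (blockb V Q) + enorm g)
      / ((1 - K * enorm g) / K))%:E)%E.
Proof.
move=> Kg; have b0 := enorm_ge0 (blockb V Q).
have N0 : 0 <= N.
  by rewrite le_min !mulr_ge0 ?invr_ge0 ?sigma_max_ge0 ?ltW.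
have K0 : 0 < K by rewrite ltr_pwDl// mulr_ge0// addr_ge0// mulr_ge0 ?cmod_ge0.
have t1 x : cmod (t x i1 0) <= enorm (blockb V Q) * enorm (t x).
  by rewrite t_b t_norm; apply: cmod_mulmx_le.
have tN x : enorm (t x) <= N * enorm (leading_part i1 r (x 0 0) (t x)).
  rewrite /N; case: (leP (_ / rm)) => _.
    rewrite t_norm.
    apply: (@le_leading_part_sub _ _ _ _ _ _ _ _ (lshift k.+1 \o lift 0)) => //.
    - by move=> i j /lshift_inj/lift_inj.
    - by move=> i; apply: t_D.
  by exact: (le_leading_part_tail _ (t1 x)).
have g_le : enorm (V ^t* *m g) <= enorm g by rewrite enorm_isometry.
have xE x : enorm x ^+ 2 = cmod (x 0 0) ^+ 2 + enorm (t x) ^+ 2.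
  by rewrite t_norm enorm_split.
apply: cond_number_le; first by rewrite divr_gt0// subr_gt0.
  move=> x; rewrite -(enorm_isometry (X2T *m x) unitaryV) filtered_coordinates.
  exact: (filtered_vector_le r1 r_max (t1 x) g_le (enorm_ge0 x) (xE x)).
move=> x; rewrite -(enorm_isometry (X2T *m x) unitaryV) filtered_coordinates.
exact: (le_filtered_vector r1 r_max (t1 x) g_le (enorm_ge0 x) (xE x)).
Qed.

End FixedDistance.

(** * Uniformity as the distance tends to zero *)

(** Here a, s, eps stand for |r_1|, ||b||, ||q_1 - v_1||, and N' is the
    minimum of N and nu = 2 / mu. Because of N' <= nu, K is at most the constant
    K0, so that every error term is a product of constants and d; N' is replaced
    by N only in the main term. *)
Lemma asymptotic_bound (R : realType) (C c nu d s eps a m2 N N' : R) :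
  let K0 := 1 + (C + c * C + 1) * nu in
  let M0 := C + 1 + c + (c + 1) * C in
  let K := 1 + (a * s + 1) * N' in
  0 < d -> d <= 1 -> 2 * K0 * C * d <= 1 ->
  0 <= C -> 0 <= c -> 0 <= s -> s <= eps -> eps <= C * d ->
  0 <= a -> a <= d^-1 + c -> 1 <= m2 -> m2 <= 1 + c ->
  0 <= N' -> N' <= N -> N' <= nu ->
  K * eps < 1 /\
  (m2 + a * s + eps) / ((1 - K * eps) / K) <=
  (s / d + m2) * ((s / d + 1) * N + 1)
    + (M0 * (c * C * nu) + (c + 1) * C * K0 + 2 * M0 * K0 ^+ 2 * C) * d.
Proof.
move=> K0 M0 K d0 d1 Kd C0 c0 s0 s_eps eps_C a0 a_le m21 m2c N0 NN Nnu.
set q := s / d; set M := q + m2; set P := m2 + a * s + eps.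
have q0 : 0 <= q by rewrite divr_ge0 // ltW.
have sC : s <= C * d by lra.
have qC : q <= C by rewrite ler_pdivrMr.
have Cd_C : C * d <= C by rewrite ler_piMr.
have as_q : a * s <= q + c * C * d.
  have := ler_wpM2r s0 a_le; rewrite mulrDl [d^-1 * s]mulrC -/q.
  by have := ler_wpM2l c0 sC; lra.
have as0 : 0 <= a * s by rewrite mulr_ge0.
have cCd0 : 0 <= c * C * d by rewrite !mulr_ge0// ltW.
have cCd : c * C * d <= c * C by rewrite ler_piMr// mulr_ge0.
have K_ge1 : 1 <= K by rewrite lerDl mulr_ge0// addr_ge0.
have KK0 : K <= K0.
  by rewrite lerD2l ler_pM// ?addr_ge0//; lra.
have K0_ge1 : 1 <= K0 by lra.
have eps0 : 0 <= eps by lra.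
have Keps : K * eps <= 2^-1.
  have : K * eps <= K0 * (C * d) by rewrite ler_pM//; lra.
  lra.
split; first by lra.
have P0 : 0 <= P by rewrite /P; lra.
have PM : P <= M + (c + 1) * C * d by rewrite /P /M; lra.
have PM0 : P <= M0.
  have := Cd_C; rewrite /M0; move: PM; rewrite /M; lra.
have MM0 : M <= M0.
  have : 0 <= (c + 1) * C by rewrite mulr_ge0 ?addr_ge0.
  rewrite /M0 /M; lra.
have M0_ge0 : 0 <= M by rewrite /M; lra.
have nu0 : 0 <= nu by lra.
have K_le : K <= ((q + 1) * N + 1) + c * C * nu * d.
  have h1 : (a * s + 1) * N' <= (q + 1) * N' + c * C * d * N'.
    by rewrite -mulrDl ler_wpM2r//; lra.
  have h2 : (q + 1) * N' <= (q + 1) * N by rewrite ler_wpM2l//; lra.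
  have h3 : c * C * d * N' <= c * C * d * nu by rewrite ler_wpM2l.
  rewrite /K; lra.
(* As K eps <= 1/2, the inverse of 1 - K eps is at most 1 + 2 K eps. *)
have inv_le : P / ((1 - K * eps) / K) <= P * K * (1 + 2 * (K * eps)).
  rewrite invf_div [P * (K / _)]mulrA ler_pdivrMr ?subr_gt0; last by lra.
  have PK0 : 0 <= P * K by rewrite mulr_ge0//; lra.
  rewrite -[leRHS]mulrA ler_peMr//.
  have u0 : 0 <= K * eps by rewrite mulr_ge0//; lra.
  have := mulr_ge0 u0 (_ : 0 <= 1 - 2 * (K * eps)).
  move=> /(_ ltac:(lra)); lra.
apply: le_trans inv_le _.
have e1 : P * K <= M * ((q + 1) * N + 1) + M0 * (c * C * nu) * d
    + (c + 1) * C * K0 * d.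
  have f1 : P * K <= (M + (c + 1) * C * d) * K by rewrite ler_wpM2r//; lra.
  have f2 : M * K <= M * (((q + 1) * N + 1) + c * C * nu * d).
    by rewrite ler_wpM2l.
  have f3 : M * (c * C * nu * d) <= M0 * (c * C * nu * d).
    by rewrite ler_wpM2r// !mulr_ge0// ltW.
  have f4 : (c + 1) * C * d * K <= (c + 1) * C * d * K0.
    by rewrite ler_wpM2l// !mulr_ge0 ?addr_ge0// ltW.
  lra.
have e2 : P * K * (2 * (K * eps)) <= 2 * M0 * K0 ^+ 2 * C * d.
  have g1 : K * (K * eps) <= K0 * (K0 * (C * d)).
    have K00 : 0 <= K by lra.
    by apply: ler_pM => //; [rewrite mulr_ge0|apply: ler_pM].
  have g2 : P * (K * (K * eps)) <= M0 * (K0 * (K0 * (C * d))).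
    have K00 : 0 <= K by lra.
    by apply: ler_pM => //; rewrite !mulr_ge0.
  rewrite expr2; lra.
rewrite mulrDr mulr1; lra.
Qed.

(** The bound for a single d, with an error constant that depends on d neither
    directly nor through the matrices. *)
Lemma cond_number_bound (R : realType) (p k l : nat)
    (A V : 'M[R[i]]_(p.+1 + k.+1)) (lam : 'rV[R[i]]_(p.+1 + k.+1))
    (w z : 'I_l -> R[i]) (js : 'I_l) (theta d W delta mu C : R)
    (Q : 'M[R[i]]_(p.+1 + k.+1, p.+1)) :
  let r := fun i => ratfilter w z (lam 0 i) in
  let c := l%:R * (W / delta) in
  let K0 := 1 + (C + c * C + 1) * (2 / mu) in
  let M0 := C + 1 + c + (c + 1) * C in
  let s := enorm (blockb V Q) in
  0 < delta -> 0 < mu -> dangerous_filter A V lam w z js theta d ->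
  single_danger lam w z js W delta mu ->
  Q ^t* *m Q = 1%:M -> blockD V Q \in unitmx ->
  0 <= C -> enorm (col ord0 Q - col ord0 (targetV V)) <= C * d ->
  0 < d -> d <= 1 -> 2 * K0 * C * d <= 1 -> C * d <= 2^-1 ->
  (cond_number (ratfilter_mx w z A *m Q *m scalingT p (r (idx1 p k))) <=
    ((s / d + Num.max 1 (cmod (r (idx2 p k)))) *
     ((s / d + 1) * spectral_norm (invmx (blockD V Q))
        / cmod (r (idxm p k)) + 1)
     + (M0 * (c * C * (2 / mu)) + (c + 1) * C * K0 + 2 * M0 * K0 ^+ 2 * C)
       * d)%:E)%E.
Proof.
move=> r c K0 M0 s delta0 mu0 df sd QQ Du C0 gC d0 d1 Kd Cd.
have [_ VV AV r_neq0 r_order _ _ dist _ wjs] := df.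
have [wW sep r_mu] := sd.
have zd : cmod (z js - lam 0 (idx1 p k)) = d by rewrite dist cmod_polar// ltW.
have poles i j : z j != lam 0 i.
  rewrite -subr_eq0 -cmod_gt0; have [[-> ->]|ij] := eqVneq (i, j) (idx1 p k, js).
    by rewrite zd.
  exact: lt_le_trans delta0 (sep _ _ ij).
have W0 : 0 <= W := le_trans (cmod_ge0 _) (wW js).
have c0 : 0 <= c by rewrite !mulr_ge0// invr_ge0 ltW.
have r1_le : cmod (r (idx1 p k)) <= d^-1 + c.
  apply: (ratfilter_near_pole_le delta0 wW wjs zd) => j jjs.
  by apply: sep; rewrite xpair_eqE eqxx.
have ri_le i : i != idx1 p k -> cmod (r i) <= c.
  move=> i1; apply: (ratfilter_partial_le delta0 wW) => j _.
  by apply: sep; rewrite xpair_eqE (negPf i1).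
have v2 : idx2 p k = 1%N :> nat.
  by rewrite /idx2 inordK// -[X in (_ < X)%N]/(p.+1 + k.+1)%N addnS.
set m2 := Num.max 1 _.
have m2_le : m2 <= 1 + c.
  rewrite ge_max lerDl c0 /=; apply: le_trans (ri_le _ _) _.
    by rewrite -val_eqE /= v2.
  by rewrite lerDr.
have r_m2 i : i != idx1 p k -> cmod (r i) <= m2.
  move=> i1; rewrite le_max; apply/orP; right; apply: r_order.
  by rewrite v2 lt0n; apply: contra i1 => /eqP i0; apply/eqP/val_inj.
set rm := cmod (r (idxm p k)).
have rm0 : 0 < rm by rewrite cmod_gt0; exact: r_neq0.
have r_rm (i : 'I_p) : rm <= cmod (r (lshift k.+1 (lift 0 i))).
  by apply: r_order; rewrite /= /bump /= add1n.
have s_eps : s <= enorm (col ord0 Q - col ord0 (targetV V)) by apply: blockb_le.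
have s2 : s <= 2^-1 by lra.
set N := spectral_norm (invmx (blockD V Q)) / rm.
set N' := Num.min N (2 / mu).
have N'0 : 0 <= N' by rewrite le_min !mulr_ge0 ?invr_ge0 ?sigma_max_ge0// ltW.
have m2_ge1 : 1 <= m2 by rewrite le_max lexx.
have N'N : N' <= N by rewrite ge_min lexx.
have N'mu : N' <= 2 / mu by rewrite ge_min lexx orbT.
have r_max i : cmod (r i) <= cmod (r (idx1 p k)) by apply: r_order.
have [Keps bound] := asymptotic_bound d0 d1 Kd C0 c0 (enorm_ge0 _) s_eps gC
  (cmod_ge0 _) r1_le m2_ge1 m2_le N'0 N'N N'mu.
apply: le_trans (cond_number_filtered_le VV QQ AV poles (r_neq0 _) r_max m2_ge1
  r_m2 rm0 r_rm mu0 r_mu s2 Du Keps) _.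
by rewrite lee_fin -(mulrA (s / d + 1)).
Qed.

Theorem theorem4p1 (R : realType) (p k l : nat)
  (A V : R -> 'M[R[i]]_(p.+1 + k.+1)) (lam : R -> 'rV[R[i]]_(p.+1 + k.+1))
  (w z : R -> 'I_l -> R[i]) (js : 'I_l) (theta : R -> R)
  (Q : R -> 'M[R[i]]_(p.+1 + k.+1, p.+1))
  (W delta mu : R) :
  let r := fun d : R => ratfilter (w d) (z d) in
  let X2 := fun d : R => ratfilter_mx (w d) (z d) (A d) *m Q d in
  let b := fun d : R => blockb (V d) (Q d) in
  let D := fun d : R => blockD (V d) (Q d) in
  let T := fun d : R => scalingT p (r d (lam d 0 (idx1 p k))) in
  let M := fun d : R => enorm (b d) / d
    + Num.max 1 (cmod (r d (lam d 0 (idx2 p k)))) in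
  0 < delta -> 0 < mu ->
  (\forall d \near 0^'+,
    dangerous_filter (A d) (V d) (lam d) (w d) (z d) js (theta d) d) ->
  (\forall d \near 0^'+,
    single_danger (lam d) (w d) (z d) js W delta mu) ->
  (\forall d \near 0^'+, (Q d) ^t* *m Q d = 1%:M) ->
  (\forall d \near 0^'+, D d \in unitmx) ->
  (fun d : R => enorm (col ord0 (Q d) - col ord0 (targetV (V d))))
    =O_ (0^'+) (id : R -> R) ->
  (fun d : R => enorm (b d)) =O_ (0^'+) (id : R -> R)
  /\ exists2 e : R -> R,
       e =O_ (0^'+) (id : R -> R) &
       \forall d \near 0^'+,
         (cond_number (X2 d *m T d) <=
          (M d * ((enorm (b d) / d + 1) * spectral_norm (invmx (D d))
                    / cmod (r d (lam d 0 (idxm p k))) + 1) + e d)%:E)%E.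
Proof.
move=> r X2 b D T M delta0 mu0 df sd QQ Du /eqO_exP[C C0 gC].
have d_gt0 : \forall d \near (0 : R)^'+, 0 < d by exact: nbhs_right_gt.
have small (B : R) : \forall d \near (0 : R)^'+, B * d <= 1.
  have B1 : 0 < (`|B| + 1)^-1 by rewrite invr_gt0 ltr_wpDl.
  near=> d.
  have dp : 0 < d by near: d.
  have dB : d < (`|B| + 1)^-1 by near: d; exact: nbhs_right_lt.
  apply: (@le_trans _ _ ((`|B| + 1) * d)).
    by rewrite ler_wpM2r ?(ltW dp)// (le_trans (ler_norm B))// lerDl.
  by rewrite mulrC -ler_pdivlMr ?ltr_wpDl// mul1r ltW.
split.
  apply/eqO_exP; exists C => //; near=> d.
  have VV : (V d) ^t* *m V d = 1%:M.
    by apply: (@df_orthonormal _ _ _ _ _ _ _ _ _ _ _ _ (near df d _)).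
  rewrite ger0_norm ?enorm_ge0//.
  have := near gC d; rewrite ger0_norm ?enorm_ge0// => /(_ _)/(le_trans _)->//.
  by apply: blockb_le => //; near: d.
pose c := l%:R * (W / delta).
pose K0 := 1 + (C + c * C + 1) * (2 / mu).
pose M0 := C + 1 + c + (c + 1) * C.
pose E := M0 * (c * C * (2 / mu)) + (c + 1) * C * K0 + 2 * M0 * K0 ^+ 2 * C.
exists (fun d => E * d).
  apply/eqO_exP; exists (`|E| + 1); first by rewrite ltr_wpDl.
  by near=> d; rewrite normrM ler_wpM2r// lerDl.
near=> d.
have dp : 0 < d by near: d.
apply: (@cond_number_bound _ _ _ _ _ _ _ _ _ js (theta d) d W delta mu C) => //.
- by near: d.
- by near: d.
- by near: d.
- by near: d.
- by rewrite ltW.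
- have := near gC d; rewrite /= !ger0_norm ?enorm_ge0 ?(ltW dp)// => ->//.
- by rewrite -[d]mul1r; near: d; exact: small.
- by near: d; exact: small.
- rewrite -(ler_pM2l (ltr0Sn R 1)) mulrA divff//.
  by near: d; exact: small.
Unshelve. all: by end_near. Qed.
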